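(* Let $\mathcal{I}_1$ and $\mathcal{I}_2$ be two proper admissible ideals on $\mathbb{N}$ such that $\mathcal{I}_1 \leq_{1\text{-}1} \mathcal{I}_2$, and let $X$ be a Tychonoff space. If $X$ is $\mathcal{I}_1$-H-separable, then $X$ is $\mathcal{I}_2$-H-separable.
   Context: An ideal on $\mathbb{N}$ is a family of subsets of $\mathbb{N}$ closed under finite unions and under subsets; it is admissible if it contains every singleton and proper if it does not contain $\mathbb{N}$. For families $\mathcal{A}_1,\mathcal{A}_2$ of subsets of $\mathbb{N}$, $\mathcal{A}_1 \leq_{1\text{-}1} \mathcal{A}_2$ means that there is a one-to-one function $\varphi:\mathbb{N}\to\mathbb{N}$ such that $\varphi^{-1}(A)\in\mathcal{A}_2$ for all $A\in\mathcal{A}_1$. For an ideal $\mathcal{I}$ on $\mathbb{N}$, a space $X$ is $\mathcal{I}$-H-separable if for every sequence $(Y_n)_{n\in\mathbb{N}}$ of dense subspaces of $X$ there is a sequence $(F_n)_{n\in\mathbb{N}}$ such that each $F_n$ is a finite subset of $Y_n$ and for every nonempty open set $U$ of $X$, $\{n\in\mathbb{N} : U\cap F_n=\emptyset\}\in\mathcal{I}$. *)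

(* Defs.v *)
From HB Require Import structures.
From mathcomp Require Import all_boot all_order all_algebra.
From mathcomp Require Import all_classical all_reals all_analysis.

Set Implicit Arguments.
Unset Strict Implicit.
Unset Printing Implicit Defensive.

Import numFieldNormedType.Exports.

Local Open Scope classical_set_scope.

(* [I set0] is the empty finite union; binary unions give the other ones. *)
Definition ideal (I : set_system nat) : Prop :=
  [/\ I set0, setU_closed I & forall A B : set nat, B `<=` A -> I A -> I B].

Definition admissible (I : set_system nat) : Prop :=
  forall n : nat, I [set n].

Definition proper_family (I : set_system nat) : Prop := ~ I setT.

Definition le_1_1 (A1 A2 : set_system nat) : Prop :=
  exists phi : nat -> nat,
    injective phi /\ forall A : set nat, A1 A -> A2 (phi @^-1` A).

Definition ideal_H_separable (I : set_system nat) (X : topologicalType) : Prop :=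
  forall Y : nat -> set X, (forall n, dense (Y n)) ->
  exists F : nat -> set X,
    (forall n, finite_set (F n) /\ F n `<=` Y n) /\
    (forall U : set X, open U -> U !=set0 -> I [set n | U `&` F n = set0]).

(* Accessible means T1. The library phrases complete regularity with
   [uniform_separator]; [tychonoff_spaceP] gives the form with real-valued
   continuous functions. *)
Definition tychonoff_space (X : topologicalType) : Prop :=
  accessible_space X /\ completely_regular_space X.

Lemma tychonoff_spaceP (R : realType) (X : topologicalType) :
  tychonoff_space X <->
  accessible_space X /\
  forall (a : X) (B : set X), closed B -> ~ B a ->
    exists f : X -> R, [/\ continuous f, range f `<=` `[0%R, 1%R],
      f a = 0%R & forall b, B b -> f b = 1%R].
Proof.
split=> -[T1 cr]; split=> // a B clB nBa.
  have /(@uniform_separatorP _ R)[f [cf f01 f0 f1]] := cr a B clB nBa.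
  exists f; split=> //; first by apply: f0; exists a.
  by move=> b Bb; apply: f1; exists b.
have [f [cf f01 f0 f1]] := cr a B clB nBa.
apply/(@uniform_separatorP _ R); exists f; split=> //.
  by move=> _ [_ -> <-].
by move=> _ [b Bb <-]; exact: f1.
Qed.

(* Main.v *)
Require Import Defs.
From mathcomp Require Import all_boot all_order all_algebra.
From mathcomp Require Import all_classical all_reals all_analysis.

(** Let [phi] be a one-to-one witness of [le_1_1 I1 I2]. A sequence [Y] of dense
    sets is spread out along [phi]: as [phi] is injective, there is a sequence
    [Z] of dense sets with [Z (phi n) = Y n], the whole space standing at the
    indices that [phi] misses. If finite sets [G m] in [Z m] witness
    I1-H-separability for [Z], then the sets [G (phi n)] lie in [Y n], and the
    indices at which they miss an open set [U] form the preimage by [phi] of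
    those at which [G] misses [U]; the choice of [phi] sends that preimage
    to [I2]. *)

(** Intersecting [Y] over the fibres of [phi] is the spread-out sequence: a fibre
    of an injection has at most one point, and the intersection over an empty
    fibre is the whole space. *)
Lemma dense_bigcap_fiber (X : topologicalType) (phi : nat -> nat)
    (Y : nat -> set X) (m : nat) :
  injective phi -> (forall n, dense (Y n)) ->
  dense (\bigcap_(n in (phi @^-1` [set m])%classic) Y n)%classic.
Proof.
move=> phi_inj Yd.
have [[n phin]|nophi] := pselect (exists n, phi n = m).
  move=> U U0 Uo; have [x [Ux Yx]] := Yd n U U0 Uo.
  exists x; split=> // k /= phik.
  by rewrite (phi_inj k n) // phik phin.
move=> U [x Ux] _; exists x; split=> // k phik.
by case: nophi; exists k.
Qed.

Theorem theorem3p2 (I1 I2 : set_system nat) (X : topologicalType)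
  (ideal1 : ideal I1) (admissible1 : admissible I1) (proper1 : proper_family I1)
  (ideal2 : ideal I2) (admissible2 : admissible I2) (proper2 : proper_family I2)
  (leI12 : le_1_1 I1 I2) (tychonoffX : tychonoff_space X) :
  ideal_H_separable I1 X -> ideal_H_separable I2 X.
Proof.
move=> sepX Y Yd; have [phi [phi_inj phiI]] := leI12.
have [G [GZ GI]] := sepX _ (fun m => @dense_bigcap_fiber X phi Y m phi_inj Yd).
exists (fun n => G (phi n)); split=> [n|U Uo U0].
  have [Gfin Gsub] := GZ (phi n).
  by split=> // x /Gsub; apply.
exact: phiI (GI U Uo U0).
Qed.
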